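(* Let $\lambda$ and $\mu$ be partitions, and let $d$ be an integer with $d\le|\lambda|+|\mu|$. Let $e,f\ge 1$ and $x_1,\dots,x_e,y_1,\dots,y_f\in\mathbb R_{\ge 0}$. Then the sequence $$i\mapsto s_{\lambda}^{(|\lambda|+|\mu|-d-i)}(x_1,\dots,x_e)\, s_{\mu}^{(i)}(y_1,\dots,y_f)\qquad(i\in\mathbb Z)$$ is log-concave.
   Context: A sequence $(a_i)_{i\in\mathbb Z}$ of non-negative real numbers is log-concave if $a_{i-1}a_{i+1}\le a_i^2$ for all $i$. Schur polynomials (convention): a partition $\lambda$ of $b\ge1$ is a sequence $0\le\lambda_N\le\cdots\le\lambda_1$ of integers with $|\lambda|:=\sum_i\lambda_i=b$. In $e\ge 1$ variables, $s_\lambda=\det(c_{\lambda_i-i+j})_{1\le i,j\le N}$, where $c_k$ is the $k$-th elementary symmetric polynomial in $x_1,\dots,x_e$ ($c_0=1$, $c_k=0$ for $k<0$ or $k>e$). Derived Schur polynomials: $s_\lambda^{(i)}(x_1,\dots,x_e)$, $0\le i\le|\lambda|$, are defined by $s_\lambda(x_1+t,\dots,x_e+t)=\sum_{i=0}^{|\lambda|}s_\lambda^{(i)}(x_1,\dots,x_e)t^i$ for all $t\in\mathbb R$, and $s_\lambda^{(i)}=0$ for $i\notin\{0,\dots,|\lambda|\}$. *)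

(* Defs.v *)
From mathcomp Require Import all_boot all_order all_algebra perm.
From mathcomp Require Import mpoly.
From mathcomp Require Import reals.

Set Implicit Arguments.
Unset Strict Implicit.
Unset Printing Implicit Defensive.

Import Order.TTheory GRing.Theory Num.Theory.
Local Open Scope ring_scope.

(* Log-concavity is only defined for sequences of non-negative numbers, so
   non-negativity is part of the definition. *)
Definition log_concave (R : realType) (a : int -> R) : Prop :=
  (forall i : int, 0 <= a i) /\
  (forall i : int, a (i - 1) * a (i + 1) <= a i ^+ 2).

(* The list is [:: la_1; ...; la_N], trailing zeros are allowed, and the
   size |la| of the partition is sumn la. *)
Definition is_partition (la : seq nat) : bool :=
  sorted geq la && (0 < sumn la)%N.

(* c_k for k in Z; mesym n R k is already 0 for k > n. *)
Definition elem_sym (n : nat) (R : comNzRingType) (k : int) : {mpoly R[n]} :=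
  if k is Posz m then mesym n R m else 0.

(* Convention: the elementary symmetric polynomials are used, so this is the
   Schur polynomial of the conjugate partition in the other common
   convention.  The shift k - i + j is the same for indices starting at 0 and
   at 1. *)
Definition schur (n : nat) (R : comNzRingType) (la : seq nat) :
    {mpoly R[n]} :=
  \det (\matrix_(i < size la, j < size la)
          elem_sym n R ((nth 0%N la i)%:Z - i%:Z + j%:Z)).

(* p(x_1 + t, ..., x_n + t), as a polynomial in t. *)
Definition translate (n : nat) (R : comNzRingType) (p : {mpoly R[n]}) :
    {poly {mpoly R[n]}} :=
  mmap (polyC \o @mpolyC n R) (fun j : 'I_n => ('X_j)%:P + 'X) p.

(* The cut-off at sumn la is redundant, see size_translate_schur; the property
   that defines these polynomials is schur_derivedP. *)
Definition schur_derived (n : nat) (R : comNzRingType) (la : seq nat)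
    (i : int) : {mpoly R[n]} :=
  if i is Posz k then
    if (k <= sumn la)%N then (translate (schur n R la))`_k else 0
  else 0.

Lemma meval_translate (n : nat) (R : comNzRingType) (p : {mpoly R[n]})
    (x : 'I_n -> R) (t : R) :
  p.@[fun j => x j + t] = (map_poly (meval x) (translate p)).[t].
Proof.
rewrite mevalE /translate /mmap rmorph_sum horner_sum; apply: eq_bigr => m _.
rewrite rmorphM /= map_polyC /= mevalC hornerM hornerC; congr (_ * _).
rewrite /mmap1 rmorph_prod horner_prod; apply: eq_bigr => j _.
by rewrite rmorphXn rmorphD /= map_polyC map_polyX /= mevalXU !hornerE.
Qed.

Lemma size_translate_mesym (n : nat) (R : comNzRingType) (k : nat) :
  (size (translate (mesym n R k)) <= k.+1)%N.
Proof.
rewrite /translate rmorph_sum.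
apply: (leq_trans (size_sum _ _ _)); apply/bigmax_leqP => h /eqP <-.
rewrite rmorph_prod; apply: (leq_trans (size_poly_prod_leq _ _)).
rewrite leq_subLR addnS ltnS addnn -mul2n mulnC -sum_nat_const.
by apply: leq_sum => j _; rewrite /= mmapX mmap1U addrC size_XaddC.
Qed.

Lemma size_translate_schur (n : nat) (R : comNzRingType) (la : seq nat) :
  (size (translate (schur n R la)) <= (sumn la).+1)%N.
Proof.
rewrite /schur /determinant /translate rmorph_sum.
apply: (leq_trans (size_sum _ _ _)); apply/bigmax_leqP => s _.
rewrite rmorphMsign size_Msign; set P := (X in polyseq X).
have [z|nz] := eqVneq P 0; first by rewrite z size_poly0.
move: nz; rewrite {}/P rmorph_prod => nz.
set k := fun i : 'I_(size la) => (nth 0%N la i)%:Z - i%:Z + (s i)%:Z.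
have k0 i : 0 <= k i.
  apply: contraNT nz => ki; apply/eqP; rewrite (bigD1 i) //= mxE -/(k i).
  by case: (k i) ki => // m _; rewrite rmorph0 mul0r.
apply: (leq_trans (size_poly_prod_leq _ _)); rewrite leq_subLR addnS ltnS.
have -> : #|(xpredT : pred 'I_(size la))| = size la by rewrite card_ord.
apply: (@leq_trans (\sum_(i < size la) (`|k i|%N + 1))).
  apply: leq_sum => i _; rewrite mxE -/(k i); case: (k i) (k0 i) => // m _.
  by rewrite addn1; apply: size_translate_mesym.
rewrite big_split /= sum1_card card_ord addnC leq_add2l.
have PoszS (F : 'I_(size la) -> nat) :
    (\sum_i F i)%N%:Z = \sum_i (F i)%:Z :> int.
  by apply: (big_morph Posz PoszD).
rewrite -lez_nat PoszS (eq_bigr k) => [|i _]; last by rewrite gez0_abs.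
have sumS : \sum_(i < size la) (s i)%:Z = \sum_(i < size la) i%:Z.
  by rewrite [RHS](reindex_inj (@perm_inj _ s)).
by rewrite /k big_split sumrB /= sumS addrNK sumnE (big_nth 0%N) big_mkord PoszS.
Qed.

Lemma schur_derivedP (n : nat) (R : comNzRingType) (la : seq nat)
    (x : 'I_n -> R) (t : R) :
  (schur n R la).@[fun j => x j + t] =
    \sum_(i < (sumn la).+1) (schur_derived n R la i%:Z).@[x] * t ^+ i.
Proof.
rewrite meval_translate (@horner_coef_wide _ (sumn la).+1); last first.
  by apply: leq_trans (size_poly _ _) (size_translate_schur _ _ _).
by apply: eq_bigr => i _; rewrite coef_map /= -ltnS ltn_ord.
Qed.

(* Main.v *)
Require Import Defs.
From HB Require Import structures.
From mathcomp Require Import all_boot all_order all_algebra.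
From mathcomp Require Import perm mpoly.
From mathcomp Require Import polyrcf.
From mathcomp Require Import reals ring lra zify.

(* The sequence i |-> s_la^(i)(x) is itself log-concave and non-negative for
   x >= 0, and a product of such sequences, one of them reversed, is again
   log-concave.

   The Vandermonde determinant is translation invariant and its product with
   s_la is an alternant F = det (x_i ^ l_j), so up to constants s_la^(i)(x) is
   D^i F (x), where D = sum_i d/dx_i.  It suffices that every D^k F is positive
   or zero and log-concave on the chamber 0 < x_1 < ... < x_n, because
   log-concavity in the direction (1, ..., 1) reads D^k F * D^(k+2) F <=
   (D^(k+1) F)^2.  This property of homogeneous polynomials is stable under
   - multiplication by a variable, since
     D^k (x_r p) = x_r D^k p + k D^(k-1) p;
   - integration of x_r from x_(r-1) to x_r, which commutes with D: this is a
     one-dimensional Brunn-Minkowski inequality, proved infinitesimally.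
   Every alternant is built by these operations: if all l_j > 0 one factors out
   the product of the variables, and if l_1 = 0 then F is the iterated integral
   of an alternant in one variable less over the points interlacing x.
   The case of general x >= 0 follows by sorting x and perturbing it. *)

Set Implicit Arguments.
Unset Strict Implicit.
Unset Printing Implicit Defensive.

Import Order.TTheory GRing.Theory Num.Theory.
Local Open Scope ring_scope.

(** * Directional derivatives *)

Section Directional.
Context (n : nat) (R : comNzRingType).
Implicit Types (p q : {mpoly R[n]}) (v w : 'I_n -> R).

Definition dir v p := \sum_i v i *: p^`M(i).

Fact dir_is_linear v : linear (dir v).
Proof.
move=> c p q; rewrite /dir scaler_sumr -big_split; apply: eq_bigr => i _ /=.
by rewrite linearP scalerDr !scalerA mulrC.
Qed.

HB.instance Definition _ v := GRing.isLinear.Build R {mpoly R[n]} {mpoly R[n]}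
  _ (dir v) (dir_is_linear v).

Lemma dirM v p q : dir v (p * q) = dir v p * q + p * dir v q.
Proof.
rewrite /dir mulr_suml mulr_sumr -big_split; apply: eq_bigr => i _ /=.
by rewrite mderivM scalerDr scalerAl scalerAr.
Qed.

Lemma dir0 v : dir v 0 = 0. Proof. exact: linear0. Qed.

Lemma dirD v p q : dir v (p + q) = dir v p + dir v q.
Proof. exact: linearD. Qed.

Lemma dirZ v c p : dir v (c *: p) = c *: dir v p.
Proof. exact: linearZ. Qed.

Lemma dir_comm v w p : dir v (dir w p) = dir w (dir v p).
Proof.
rewrite /dir (eq_bigr (fun i => \sum_j (v i * w j) *: p^`M(j)^`M(i))); last first.
  by move=> i _; rewrite (linear_sum (@mderiv n R i)) scaler_sumr;
     apply: eq_bigr => j _; rewrite linearZ /= scalerA.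
rewrite exchange_big; apply: eq_bigr => j _ /=.
rewrite (linear_sum (@mderiv n R j)) scaler_sumr; apply: eq_bigr => i _ /=.
by rewrite linearZ /= scalerA mulrC mderiv_comm.
Qed.

Lemma dirXU v i : dir v 'X_i = (v i)%:MP.
Proof.
rewrite /dir (bigD1 i) //= big1 => [|j ji]; last first.
  by rewrite mderivX mnm1E eq_sym (negbTE ji) scale0r scaler0.
rewrite addr0 mderivX mnm1E eqxx scale1r -mul_mpolyC.
have -> : (U_(i) - U_(i))%MM = 0%MM :> 'X_{1..n}.
  by apply/mnmP => j; rewrite mnmBE subnn mnm0E.
by rewrite mpolyX0 mulr1.
Qed.

Lemma dirC v c : dir v c%:MP = 0.
Proof. by rewrite /dir big1 // => i _; rewrite mderivC scaler0. Qed.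

Lemma dirDl v w p : dir (fun i => v i + w i) p = dir v p + dir w p.
Proof. by rewrite /dir -big_split; apply: eq_bigr => i _ /=; rewrite scalerDl. Qed.

Lemma dirZl c v p : dir (fun i => c * v i) p = c *: dir v p.
Proof. by rewrite /dir scaler_sumr; apply: eq_bigr => i _; rewrite scalerA. Qed.

Lemma eq_dir v w p : v =1 w -> dir v p = dir w p.
Proof. by move=> vw; apply: eq_bigr => i _; rewrite vw. Qed.

Lemma dir_delta i p : dir (fun j => (j == i)%:R) p = p^`M(i).
Proof.
rewrite /dir (bigD1 i) //= eqxx scale1r big1 ?addr0 // => j ji.
by rewrite (negbTE ji) scale0r.
Qed.

Lemma mderiv_homog i m p : p \is m.-homog -> p^`M(i) \is m.-1.-homog.
Proof.
move=> /dhomogP hp; apply/dhomogP => k; rewrite mcoeff_msupp mcoeff_mderiv.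
move=> nz; have /hp /= <- : (k + U_(i))%MM \in msupp p.
  by rewrite mcoeff_msupp; apply: contraNneq nz => ->; rewrite mul0rn.
by rewrite mdegD mdeg1 addn1.
Qed.

Lemma dir_homog v m p : p \is m.-homog -> dir v p \is m.-1.-homog.
Proof. by move=> hp; apply: rpred_sum => i _; apply/rpredZ/mderiv_homog. Qed.

Lemma homog0_dir v p : p \is 0.-homog -> dir v p = 0.
Proof.
move=> /dhomogP hp; suff -> : p = (p@_0)%:MP by rewrite dirC.
apply/mpolyP => k; rewrite mcoeffC; have [->|k0] := eqVneq k 0%MM.
  by rewrite mulr1.
rewrite mulr0; apply/eqP; apply: contraNT k0 => /=.
by rewrite -mcoeff_msupp => /hp /= /eqP; rewrite mdeg_eq0.
Qed.

(** Both sides are linear in [p], and by the Leibniz rule degrees add under products, so it suffices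
    to treat constants and variables. *)
Lemma euler x m p : p \is m.-homog -> (dir x p).@[x] = m%:R * p.@[x].
Proof.
move=> /dhomogP hp.
suff E k : (dir x 'X_[k]).@[x] = (mdeg k)%:R * ('X_[k] : {mpoly R[n]}).@[x].
  rewrite [in LHS](mpolyE p) [in RHS](mpolyE p).
  rewrite (linear_sum (dir x)) !(raddf_sum (meval x)) /=.
  rewrite mulr_sumr [LHS]big_seq [RHS]big_seq; apply: eq_bigr => k /hp /= dk.
  by rewrite linearZ /= !mevalZ E dk mulrCA.
have HM d e (q r : {mpoly R[n]}) : (dir x q).@[x] = d%:R * q.@[x] ->
    (dir x r).@[x] = e%:R * r.@[x] ->
    (dir x (q * r)).@[x] = (d + e)%:R * (q * r).@[x].
  move=> Hq Hr; rewrite dirM mevalD !mevalM Hq Hr natrD mulrDl; congr (_ + _).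
    by rewrite mulrA.
  by rewrite mulrCA.
have H1 : (dir x 1).@[x] = 0%:R * (1 : {mpoly R[n]}).@[x].
  by rewrite -mpolyC1 dirC meval0 mul0r.
rewrite mpolyXE_id mdegE; elim/big_rec2: _ => // i d q _ Hq; apply: (HM) => //.
elim: (k i) => [|l IHl]; rewrite ?expr0 // exprS -add1n; apply: (HM) => //.
by rewrite dirXU mevalC mevalXU mul1r.
Qed.

(** The restriction of [p] to a parametrized line, which reduces iterated directional derivatives to
    univariate calculus. *)
Definition line p x v : {poly R} :=
  mmap (@polyC R) (fun i => (x i)%:P + (v i)%:P * 'X) p.

Lemma horner_line p x v s : (line p x v).[s] = p.@[fun i => x i + v i * s].
Proof.
rewrite /line /mmap mevalE horner_sum; apply: eq_bigr => m _.
rewrite hornerM hornerC; congr (_ * _); rewrite /mmap1 horner_prod.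
by apply: eq_bigr => i _; rewrite horner_exp !hornerE.
Qed.

Lemma deriv_line p x v : (line p x v)^`() = line (dir v p) x v.
Proof.
pose f := mmap (@polyC R) (fun i => (x i)%:P + (v i)%:P * 'X).
suff H : forall p, (f p)^`() = f (dir v p) by exact: H.
have fM : {morph f : x y / x * y} := rmorphM f.
have HM q r : (f q)^`() = f (dir v q) -> (f r)^`() = f (dir v r) ->
    (f (q * r))^`() = f (dir v (q * r)).
  by move=> Hq Hr; rewrite dirM fM derivM Hq Hr -!fM -rmorphD.
have H1 : (f 1)^`() = f (dir v 1).
  by rewrite -mpolyC1 dirC /f mmap0 mmapC derivC.
have HU i : (f 'X_i)^`() = f (dir v 'X_i).
  rewrite dirXU /f mmapX mmap1U mmapC !derivE.
  by rewrite ?(mul0r,add0r,addr0,mulr1).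
move=> {p}; elim/mpolyind => [|c m p _ _ IH]; first by rewrite linear0 /f !mmap0 deriv0.
rewrite linearD /= /f !mmapD derivD -/f IH; congr (_ + _); rewrite linearZ /=.
have HX : (f 'X_[m])^`() = f (dir v 'X_[m]).
  rewrite mpolyXE_id; elim/big_rec: _ => // i q _ Hq; apply: (HM) => //.
  by elim: (m i) => [|k IHk]; rewrite ?expr0 // exprS; apply: (HM).
by rewrite /f !mmapZ derivM derivC mul0r add0r -/f HX.
Qed.

End Directional.

(** * Polynomials over real closed fields *)

Section RealPolynomials.
Context (R : rcfType).
Implicit Types (p q : {poly R}) (a b : R).

(** In characteristic zero the numbers 0, 1, 2, ... are distinct, which gives more roots than the
    degree allows. *)
Lemma horner_eq0 p : (forall s, p.[s] = 0) -> p = 0.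
Proof.
move=> p0; apply: (@roots_geq_poly_eq0 _ p [seq i%:R | i <- iota 0 (size p)]).
- by apply/allP => s _; apply/rootP.
- by rewrite map_inj_uniq ?iota_uniq // => i j /eqP; rewrite eqr_nat => /eqP.
- by rewrite size_map size_iota.
Qed.

Lemma horner_ext p q : (forall s, p.[s] = q.[s]) -> p = q.
Proof.
move=> pq; apply/eqP; rewrite -subr_eq0; apply/eqP/horner_eq0 => s.
by rewrite hornerD hornerN pq subrr.
Qed.

Lemma horner_ge0_lim p a b :
  a < b -> (forall y, a < y < b -> 0 <= p.[y]) -> 0 <= p.[b].
Proof.
move=> ab pge0; rewrite leNgt; apply/negP => pb.
have [|d d0 pd] := @poly_cont _ b p (- p.[b]); first by rewrite oppr_gt0.
pose e := Num.min d (b - a) / 2.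
have m0 : 0 < Num.min d (b - a) by rewrite lt_min d0 subr_gt0.
have e0 : 0 < e by rewrite divr_gt0.
have ed : e < d.
  by rewrite ltr_pdivrMr // (@le_lt_trans _ _ d) ?ge_min ?lexx // ltr_pMr ?ltr1n.
have eb : e < b - a.
  rewrite ltr_pdivrMr // (@le_lt_trans _ _ (b - a)) ?ge_min ?lexx ?orbT //.
  by rewrite ltr_pMr ?subr_gt0 ?ltr1n.
have /pge0 : a < b - e < b by lra.
have /pd : `|b - e - b| < d by rewrite addrAC subrr add0r normrN gtr0_norm.
by rewrite ltr_norml; lra.
Qed.

Lemma horner_ge0_lim_right p a : (forall y, a < y -> 0 <= p.[y]) -> 0 <= p.[a].
Proof.
move=> pge0; have : 0 <= (p \Po (- 'X)).[- a].
  apply: (@horner_ge0_lim _ (- a - 1)); first by lra.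
  by move=> y /andP[_ ya]; rewrite horner_comp !hornerE pge0 // ltrNr.
by rewrite horner_comp !hornerE opprK.
Qed.

Lemma horner_gt_incr p a b : a < b ->
  (forall y, a < y < b -> 0 < p^`().[y]) -> p.[a] < p.[b].
Proof.
move=> ab dp; have [c cab] := poly_mvt p ab; rewrite -subr_gt0 => ->.
by rewrite mulr_gt0 ?subr_gt0 ?dp //; rewrite in_itv in cab.
Qed.

(* The hypothesis on the derivatives says that p / f ^ 2 is nonincreasing. *)
Lemma quotient_sqr_le0 p f a b : a <= b ->
  (forall y, a <= y <= b -> 0 < f.[y]) ->
  (forall y, a <= y <= b -> p^`().[y] * f.[y] <= 2 * p.[y] * f^`().[y]) ->
  p.[a] = 0 -> p.[b] <= 0.
Proof.
move=> ab f0 dpf pa; rewrite leNgt; apply/negP => pb.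
have {ab}ab : a < b.
  by rewrite lt_neqAle ab andbT; apply: contraTneq pb => <-; rewrite pa ltxx.
have fa : 0 < f.[a] by rewrite f0 // lexx ltW.
have fb : 0 < f.[b] by rewrite f0 // lexx ltW.
have K0 : 0 < (b - a + 1) * f.[b] ^+ 2.
  by rewrite mulr_gt0 ?exprn_gt0 // ltr_wpDl ?subr_ge0 // ltW.
(* As [p / f ^ 2] is only weakly monotone, a small multiple of the increasing function [y - a + 1]
   is subtracted from it. The value of [c] makes the term subtracted from [p] at [b] equal to half
   of [p.[b]]. *)
pose c := p.[b] / ((b - a + 1) * f.[b] ^+ 2) / 2.
have c0 : 0 < c by rewrite !divr_gt0.
have cE : c * ((b - a + 1) * f.[b] ^+ 2) = p.[b] / 2.
  by rewrite /c mulrAC divfK ?gt_eqF.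
pose M : {poly R} := p - c%:P * ('X - a%:P + 1) * f ^+ 2.
have ME y : M.[y] = p.[y] - c * (y - a + 1) * f.[y] ^+ 2.
  by rewrite !hornerE.
have dME y : M^`().[y] = p^`().[y] - c * f.[y] ^+ 2
    - c * (y - a + 1) * (2 * f.[y] * f^`().[y]).
  by rewrite /M !derivE !hornerE /=; ring.
have Ma : M.[a] < 0.
  have := mulr_gt0 c0 (exprn_gt0 2 fa); rewrite ME pa; lra.
have Mb : 0 < M.[b] by rewrite ME -mulrA cE; lra.
(* The last zero of [M] before [b]: the derivative of [M] is negative there, although [M] is
   positive between [y] and [b]. *)
have [y yab [My yroot]] : exists2 y, a < y < b &
    M.[y] = 0 /\ forall z, y < z < b -> ~~ root M z.
  case: (prev_rootP M a b) => [M0|y _ My yab yr|z _ _ yr].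
  - by move: Mb; rewrite M0 horner0 ltxx.
  - by exists y; [move: yab; rewrite in_itv|split=> // z zb; apply: yr; rewrite in_itv].
  - have [||z' z'ab rz'] := @poly_ivtoo _ M a b; first exact: ltW.
      by rewrite nmulr_rlt0.
    by move: (yr z' z'ab); rewrite rz'.
have {yab} [ay yb] := andP yab.
have yab : a <= y <= b by rewrite !ltW.
have fy := f0 y yab.
have dMy : M^`().[y] < 0.
  rewrite -(pmulr_llt0 _ fy).
  have py : p.[y] = c * (y - a + 1) * f.[y] ^+ 2.
    by apply/eqP; rewrite -subr_eq0 -ME My.
  have := dpf y yab; rewrite py dME => H.
  apply: le_lt_trans (_ : - c * f.[y] ^+ 3 < 0).
    by move: H; lra.
  by rewrite mulNr oppr_lt0 mulr_gt0 ?exprn_gt0.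
have Mpos z : y < z < b -> 0 < M.[z].
  move=> /andP[yz zb]; rewrite ltNge le_eqVlt negb_or; apply/andP; split.
    by apply: yroot; rewrite yz.
  apply/negP => Mz; have [||t tzb rt] := @poly_ivtoo _ M z b.
  - exact: ltW.
  - by rewrite nmulr_rlt0.
  - rewrite in_itv /= in tzb; have /andP[zt tb] := tzb.
    by move: (yroot t); rewrite rt tb (lt_trans yz) // => /(_ isT).
have [|d d0 dM] := @poly_cont _ y M^`() (- M^`().[y]); first by rewrite oppr_gt0.
pose e := Num.min d (b - y) / 2.
have m0 : 0 < Num.min d (b - y) by rewrite lt_min d0 subr_gt0.
have e0 : 0 < e by rewrite divr_gt0.
have ed : e < d.
  by rewrite ltr_pdivrMr // (@le_lt_trans _ _ d) ?ge_min ?lexx // ltr_pMr ?ltr1n.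
have eb : e < b - y.
  rewrite ltr_pdivrMr // (@le_lt_trans _ _ (b - y)) ?ge_min ?lexx ?orbT //.
  by rewrite ltr_pMr ?subr_gt0 ?ltr1n.
have /Mpos : y < y + e < b by lra.
have [|t] := @poly_mvt _ y (y + e) M; first by lra.
rewrite in_itv /= My subr0 => /andP[yt te] ->.
have /dM : `|t - y| < d by rewrite gtr0_norm; lra.
rewrite ltr_norml => /andP[_ H]; rewrite addrAC subrr add0r pmulr_lgt0 //; lra.
Qed.

(** Let [f], [B] and [A] be the derivatives of a polynomial along r, along z, and twice along z, on
    a line in direction r. Then [P / f ^ 2] is its second derivative along z - (B / f) r, a
    direction in which its first derivative vanishes. The hypothesis is log-concavity of [f] along
    [f] times this direction. *)
Lemma level_hessian_le0 (A B f : {poly R}) a b :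
  let P := A * f ^+ 2 - 2%:R *: (B * B^`() * f) + B ^+ 2 * f^`() in
  a <= b -> (forall y, a <= y <= b -> 0 < f.[y]) ->
  (forall y, a <= y <= b ->
     f.[y] * (f.[y] * (f.[y] * A^`().[y] - B.[y] * B^`()^`().[y])
              - B.[y] * (f.[y] * B^`()^`().[y] - B.[y] * f^`()^`().[y]))
       <= (f.[y] * B^`().[y] - B.[y] * f^`().[y]) ^+ 2) ->
  P.[a] = 0 -> P.[b] <= 0.
Proof.
move=> P ab f0 Hf; apply: quotient_sqr_le0 ab f0 _ => y yab; have := Hf y yab.
have -> : P^`().[y] = A^`().[y] * f.[y] ^+ 2 + 2 * A.[y] * f.[y] * f^`().[y]
    - 2 * (B^`().[y] ^+ 2 * f.[y] + B.[y] * B^`()^`().[y] * f.[y])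
    + B.[y] ^+ 2 * f^`()^`().[y].
  rewrite /P !expr2 derivD derivB derivZ !derivM.
  by rewrite !(hornerD, hornerN, hornerZ, hornerM); ring.
have -> : P.[y] = A.[y] * f.[y] ^+ 2 - 2 * (B.[y] * B^`().[y] * f.[y])
    + B.[y] ^+ 2 * f^`().[y].
  by rewrite !(hornerD, hornerN, hornerZ, hornerM, horner_exp).
move: (A.[y]) (A^`().[y]) (B.[y]) (B^`().[y]) (B^`()^`().[y]) => u u' v v' v''.
move: (f.[y]) (f^`().[y]) (f^`()^`().[y]) => w w' w'' H.
(* The difference of the two sides of the goal is the left side of [H] minus twice this square,
   while [H] bounds that left side by the square. *)
have := sqr_ge0 (w * v' - v * w'); lra.
Qed.

End RealPolynomials.

(** * Pointwise log-concavity of homogeneous polynomials *)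

Section LogConcaveForms.
Context (n : nat) (R : rcfType).
Implicit Types (p q : {mpoly R[n]}) (v w x : 'I_n -> R).

(** The line through [x] along [v] stays in the hyperplane [x r = x s], so [p] restricts to the zero
    polynomial on it. For [r = s] the hyperplane is the whole space. *)
Lemma dir_vanish (r s : 'I_n) p v : v r = v s ->
  (forall x, x r = x s -> p.@[x] = 0) ->
  forall x, x r = x s -> (dir v p).@[x] = 0.
Proof.
move=> vrs p0 x xrs.
have L0 : line p x v = 0.
  by apply: horner_eq0 => t; rewrite horner_line p0 // xrs vrs.
have := deriv_line p x v; rewrite L0 deriv0 => /(congr1 (horner^~ 0)).
rewrite horner_line horner0 => E; rewrite [RHS]E; apply: meval_eq => i.
by rewrite mulr0 addr0.
Qed.

(** Where [p] is positive, this says that the Hessian of log p is negative semidefinite; without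
    division it also makes sense at zeros of [p]. *)
Definition log_concave_at p x :=
  forall v, p.@[x] * (dir v (dir v p)).@[x] <= (dir v p).@[x] ^+ 2.

Lemma log_concave_at0 x : log_concave_at 0 x.
Proof. by move=> v; rewrite !dir0 meval0 mul0r sqr_ge0. Qed.

Lemma log_concave_atZ c p x : log_concave_at p x -> log_concave_at (c *: p) x.
Proof.
move=> Hp v; rewrite !dirZ !mevalZ mulrACA exprMn.
by rewrite -expr2 ler_wpM2l ?sqr_ge0.
Qed.

(** Euler's identity evaluates every derivative along [x], so the inequality along [v] follows from
    the sign of one second derivative, along any shift of [v] by a multiple of [x]. *)
Lemma log_concave_at_shift m p x v c : p \is m.+1.-homog -> 0 <= p.@[x] ->
  (dir (fun i => v i - c * x i) (dir (fun i => v i - c * x i) p)).@[x] <= 0 ->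
  p.@[x] * (dir v (dir v p)).@[x] <= (dir v p).@[x] ^+ 2.
Proof.
move=> hp p0; set w := fun i => _ => Hw.
have vE q : dir v q = dir w q + c *: dir x q.
  by rewrite -dirZl -dirDl; apply: eq_dir => i; rewrite /w subrK.
have E2 : (dir x (dir x p)).@[x] = m%:R * (m.+1%:R * p.@[x]).
  by rewrite (euler _ (dir_homog x hp)) (euler _ hp).
have E3 : (dir x (dir w p)).@[x] = m%:R * (dir w p).@[x].
  by rewrite (euler _ (dir_homog w hp)).
rewrite !vE !dirD !dirZ (dir_comm w x) !mevalD !mevalZ mevalD mevalZ E2 E3.
rewrite (euler _ hp) -natr1.
set P := p.@[x] in p0 *; set A := (dir w p).@[x]; set B := (dir w _).@[x] in Hw *.
have m0 : 0 <= m%:R :> R by [].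
move: (m%:R) m0 => k k0; rewrite -subr_ge0.
have -> : (A + c * ((k + 1) * P)) ^+ 2 -
  P * (B + c * (k * A) + c * (k * A + c * (k * ((k + 1) * P)))) =
  (A + c * P) ^+ 2 + k * (c * P) ^+ 2 - P * B by ring.
rewrite subr_ge0; apply: le_trans (mulr_ge0_le0 p0 Hw) _.
by apply: addr_ge0; [exact: sqr_ge0 | apply: mulr_ge0; [|exact: sqr_ge0]].
Qed.

End LogConcaveForms.

(** * Integration between adjacent variables *)

Section Integration.
Context (n : nat) (R : rcfType).
Implicit Types (p q : {mpoly R[n]}) (v w x : 'I_n -> R).

Lemma eq_log_concave_at p x x' : x =1 x' -> log_concave_at p x -> log_concave_at p x'.
Proof. by move=> xx Hp v; rewrite -!(meval_eq _ xx). Qed.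

Definition upd x (r : 'I_n) y : 'I_n -> R := fun i => if i == r then y else x i.

Definition coord_line p x r : {poly R} :=
  line p (upd x r 0) (fun i => (i == r)%:R).

Lemma horner_coord_line p x r y : (coord_line p x r).[y] = p.@[upd x r y].
Proof.
rewrite horner_line; apply: meval_eq => i; rewrite /upd.
by case: eqP => _; rewrite ?mul1r ?add0r ?mul0r ?addr0.
Qed.

Lemma deriv_coord_line p x r : (coord_line p x r)^`() = coord_line p^`M(r) x r.
Proof. by rewrite /coord_line deriv_line dir_delta. Qed.

Lemma upd_id x r : upd x r (x r) =1 x.
Proof. by move=> i; rewrite /upd; case: eqP => [->|]. Qed.

Lemma upd_upd x r y z : upd (upd x r y) r z =1 upd x r z.
Proof. by move=> i; rewrite /upd; case: eqP. Qed.

Lemma dir_mderiv v r p : dir v p^`M(r) = (dir v p)^`M(r).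
Proof. by rewrite -!(dir_delta r) dir_comm. Qed.

(* Along the segment [x s, x r] of the coordinate r, let w_y be the direction
   with the same coordinates as v except the r-th, such that the derivative of
   p along w_y vanishes.  The second derivative of p along w_y vanishes at
   y = x s and is nonincreasing in y by log-concavity of p^`M(r). *)
Lemma hessian_le0 p r s x v : s != r ->
  (forall x, x r = x s -> p.@[x] = 0) -> x s < x r ->
  (forall y, x s <= y <= x r ->
     0 < (p^`M(r)).@[upd x r y] /\ log_concave_at p^`M(r) (upd x r y)) ->
  (dir v p).@[x] = 0 -> (dir v (dir v p)).@[x] <= 0.
Proof.
move=> sr p0 sxr Hf vp0.
pose e i : R := (i == r)%:R; pose z i := if i == r then 0 else v i.
pose L q := coord_line q x r.
have wE t q : dir (fun i => z i + t * e i) q = dir z q + t *: q^`M(r).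
  by rewrite dirDl dirZl dir_delta.
have wE2 c t q : dir (fun i => c * z i + t * e i) q = c *: dir z q + t *: q^`M(r).
  by rewrite dirDl !dirZl dir_delta.
have vE : v =1 (fun i => z i + v r * e i).
  by move=> i; rewrite /z /e; case: eqP => [->|]; rewrite ?mulr1 ?add0r ?mulr0 ?addr0.
have LE q y : (L q).[y] = q.@[upd x r y] by rewrite horner_coord_line.
have Lx q : (L q).[x r] = q.@[x] by rewrite LE; apply/meval_eq/upd_id.
have Lr q : (L q)^`() = L q^`M(r) by exact: deriv_coord_line.
set f := p^`M(r) in Hf.
have Bf : (L (dir z p))^`() = L (dir z f) by rewrite Lr -dir_mderiv.
pose P : {poly R} := L (dir z (dir z p)) * L f ^+ 2
  - 2%:R *: (L (dir z p) * (L (dir z p))^`() * L f)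
  + L (dir z p) ^+ 2 * (L f)^`().
have PE y : P.[y] = (dir z (dir z p)).@[upd x r y] * f.@[upd x r y] ^+ 2
   - 2 * ((dir z p).@[upd x r y] * (dir z f).@[upd x r y] * f.@[upd x r y])
   + (dir z p).@[upd x r y] ^+ 2 * (f^`M(r)).@[upd x r y].
  by rewrite /P Bf Lr !(hornerD, hornerN, hornerZ, hornerM, horner_exp) !LE.
(* The condition reads [dir z p = - t f]; substituting it into [P] leaves [f ^ 2] times the second
   derivative. *)
have second t y : (dir (fun i => z i + t * e i) p).@[upd x r y] = 0 ->
    P.[y] = f.@[upd x r y] ^+ 2 *
      (dir (fun i => z i + t * e i) (dir (fun i => z i + t * e i) p)).@[upd x r y].
  rewrite PE !wE !dirD !dirZ !mderivD !mderivZ -!dir_mderiv -/f !(mevalD, mevalZ).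

  set a := (dir z p).@[_]; set b := f.@[_]; set c := (dir z f).@[_].
  set d := (dir z (dir z p)).@[_]; set g := (f^`M(r)).@[_].
  by move: a b c d g => a b c d g /eqP; rewrite addr_eq0 => /eqP ->; ring.
have Pb : P.[x r] <= 0.
  apply: (@level_hessian_le0 R _ _ (L f) (x s)); first exact: ltW.
  - by move=> y /Hf [Hy _]; rewrite LE.
  - move=> y /Hf [_] /(_ (fun i => f.@[upd x r y] * z i +
      (- (dir z p).@[upd x r y]) * e i)).
    rewrite Bf !Lr -!dir_mderiv -/f !LE.
    rewrite !wE2 !dirD !dirZ !mderivD !mderivZ -!dir_mderiv -/f.
    by rewrite !(mevalD, mevalZ) !mulNr.
  (* At [y = x s] the direction with r-th coordinate [v s] is tangent to the hyperplane where [p]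
     vanishes, so the first and second derivatives along it are zero. *)
  - rewrite (second (v s)); last first.
      apply: (@dir_vanish _ _ r s) => //; rewrite /z /e /upd eqxx (negbTE sr) //.
      by rewrite mulr1 mulr0 add0r addr0.
    rewrite (@dir_vanish _ _ r s) ?mulr0 //.
    + by rewrite /z /e eqxx (negbTE sr) mulr1 mulr0 add0r addr0.
    + apply: (@dir_vanish _ _ r s) => //.
      by rewrite /z /e eqxx (negbTE sr) mulr1 mulr0 add0r addr0.
    + by rewrite /upd eqxx (negbTE sr).
move: Pb; rewrite (second (v r)); last first.
  by rewrite -LE Lx -(eq_dir p vE).
have /Hf[fx _] : x s <= x r <= x r by rewrite lexx ltW.
rewrite pmulr_rle0 ?exprn_gt0 // -LE Lx -(eq_dir p vE) -(eq_dir _ vE) //.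
Qed.

(** Subtracting a suitable multiple of [x] from [v] makes the first derivative vanish; [hessian_le0]
    applies to the new direction, and [log_concave_at_shift] leads back to [v]. *)
Lemma log_concave_at_integral m p r s x : s != r -> p \is m.-homog ->
  (forall x, x r = x s -> p.@[x] = 0) -> x s < x r -> 0 < p.@[x] ->
  (forall y, x s <= y <= x r ->
     0 < (p^`M(r)).@[upd x r y] /\ log_concave_at p^`M(r) (upd x r y)) ->
  log_concave_at p x.
Proof.
case: m => [|m] sr hp p0 sxr px Hf v.
  have /Hf[] : x s <= x r <= x r by rewrite lexx ltW.
  by rewrite -dir_delta homog0_dir // meval0 ltxx.
pose c := (dir v p).@[x] / (m.+1%:R * p.@[x]).
apply: (@log_concave_at_shift _ _ m _ _ _ c) => //; first exact: ltW.
apply: (hessian_le0 sr) => //.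
rewrite (eq_dir _ (w := fun i => v i + (- c) * x i)); last by move=> i; rewrite mulNr.
rewrite dirDl dirZl mevalD mevalZ (euler _ hp) mulNr /c divfK ?subrr //.
by rewrite mulf_neq0 ?pnatr_eq0 // gt_eqF.
Qed.

End Integration.

(** * Polynomials with log-concave diagonal derivatives *)

Section DiagLogConcave.
Context (n : nat) (R : rcfType).
Implicit Types (p q : {mpoly R[n]}) (v w x : 'I_n -> R).
Implicit Types (U V : ('I_n -> R) -> Prop).

Definition diag : {mpoly R[n]} -> {mpoly R[n]} := dir (fun _ => 1).

Lemma iter_diag_homog k m p :
  p \is m.-homog -> iter k diag p \is (m - k).-homog.
Proof.
by elim: k => [|k IH] hp /=; rewrite ?subn0 // subnS; apply/dir_homog/IH.
Qed.

Lemma iter_diagZ k c p : iter k diag (c *: p) = c *: iter k diag p.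
Proof. by elim: k => //= k ->; rewrite /diag dirZ. Qed.

Lemma iter_diag_dir k v p : iter k diag (dir v p) = dir v (iter k diag p).
Proof. by elim: k => //= k ->; rewrite /diag dir_comm. Qed.

Lemma iter_diag_mderiv k r p : iter k diag p^`M(r) = (iter k diag p)^`M(r).
Proof. by rewrite -!dir_delta iter_diag_dir. Qed.

Lemma iter_diag_mulX k r p :
  iter k diag ('X_r * p) = 'X_r * iter k diag p + k%:R *: iter k.-1 diag p.
Proof.
elim: k => [|k IH] /=; first by rewrite scale0r addr0.
rewrite IH /diag dirD dirM dirZ dirXU mpolyC1 mul1r -addrA addrCA; congr (_ + _).
case: k {IH} => [|k] /=; first by rewrite scale0r addr0 scale1r.
by rewrite -[in RHS]natr1 scalerDl scale1r addrC.
Qed.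

Lemma iter_diag_vanish k r s p : (forall x, x r = x s -> p.@[x] = 0) ->
  forall x, x r = x s -> (iter k diag p).@[x] = 0.
Proof. by move=> p0; elim: k => //= k IH; apply: dir_vanish. Qed.

(** [N] is the order of the last nonzero iterate; it can be smaller than the degree, since [diag]
    kills differences of variables. Positivity up to [N] permits division by the iterates. Beyond
    [N] they vanish at every point, not only on [U], so that their derivatives vanish too. *)
Definition diag_log_concave U p := exists N m,
  [/\ p \is m.-homog,
      forall k x, U x -> (k <= N)%N -> 0 < (iter k diag p).@[x],
      forall k x, (N < k)%N -> (iter k diag p).@[x] = 0 &
      forall k x, U x -> log_concave_at (iter k diag p) x].

Lemma diag_log_concave_ge0 U p k x :
  diag_log_concave U p -> U x -> 0 <= (iter k diag p).@[x].
Proof.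
move=> [N [m [_ pos nul _]]] Ux; have [kN|Nk] := leqP k N.
  by rewrite ltW // pos.
by rewrite nul.
Qed.

Lemma diag_log_concave_sub U V p :
  (forall x, V x -> U x) -> diag_log_concave U p -> diag_log_concave V p.
Proof.
move=> VU [N [m [hp pos nul lc]]]; exists N, m.
by split=> // k x /VU; [apply: pos|apply: lc].
Qed.

Lemma diag_log_concave1 U : diag_log_concave U 1.
Proof.
have d1 k : iter k.+1 diag 1 = 0.
  elim: k => [|k IH]; first by rewrite /= /diag -mpolyC1 dirC.
  by rewrite iterS IH /diag dir0.
exists 0%N, 0%N; split.
- exact: dhomog1.
- by move=> [|k] x // _ _; rewrite meval1 ltr01.
- by move=> [|k] x // _; rewrite d1 meval0.
- move=> [|k] x _; last by rewrite d1; apply: log_concave_at0.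
  by move=> v; rewrite /= -mpolyC1 !dirC ?dir0 meval0 mulr0 sqr_ge0.
Qed.

Lemma diag_log_concaveZ U c p :
  0 < c -> diag_log_concave U p -> diag_log_concave U (c *: p).
Proof.
move=> c0 [N [m [hp pos nul lc]]]; exists N, m; split.
- exact: dhomogZ.
- by move=> k x Ux kN; rewrite iter_diagZ mevalZ mulr_gt0 // pos.
- by move=> k x kN; rewrite iter_diagZ mevalZ nul // mulr0.
- by move=> k x Ux; rewrite iter_diagZ; apply/log_concave_atZ/lc.
Qed.

(** Logarithms add: without denominators, the defect of the product is a square plus [x r ^ 2] times
    the defect of [p]. *)
Lemma log_concave_at_mulX r p x : log_concave_at p x -> log_concave_at ('X_r * p) x.
Proof.
move=> Hp v; have := Hp v; rewrite !dirM !dirXU dirD !dirM !dirXU dirC mul0r add0r.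
rewrite !(mevalD, mevalM, mevalC, mevalXU).
move: (p.@[x]) ((dir v p).@[x]) ((dir v (dir v p)).@[x]) (x r) (v r).
move=> a b c y t H; rewrite -subr_ge0.
have -> : (t * a + y * b) ^+ 2 - y * a * (t * b + (t * b + y * c)) =
  t ^+ 2 * a ^+ 2 + y ^+ 2 * (b ^+ 2 - a * c) by ring.
by apply: addr_ge0; apply: mulr_ge0; rewrite ?sqr_ge0 ?subr_ge0.
Qed.

(* On the kernel of d(diag p) the Hessians of p and of diag p are both
   nonpositive. *)
Lemma log_concave_at_mulXD m r c p x : p \is m.-homog -> 0 <= c -> 0 < x r ->
  0 < p.@[x] -> 0 < (diag p).@[x] -> 0 <= (diag (diag p)).@[x] ->
  log_concave_at p x -> log_concave_at (diag p) x ->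
  log_concave_at ('X_r * diag p + c *: p) x.
Proof.
move=> hp c0 xr px qx qqx lp lq.
have hq := dir_homog (fun _ => 1) hp; rewrite -/diag in hq.
case: m => [|[|m]] in hp hq *.
(* In degree 0 [diag p] would vanish; in degree 1 it is constant, so the whole polynomial is linear
   and has no second derivative. *)
- by move: qx; rewrite /diag homog0_dir // meval0 ltxx.
- move=> v; suff -> : dir v (dir v ('X_r * diag p + c *: p)) = 0.
    by rewrite meval0 mulr0 sqr_ge0.
  rewrite !(dirD, dirM, dirZ, dirXU) (homog0_dir v hq).
  rewrite (homog0_dir v (dir_homog v hp)) dirC.
  by rewrite ?dir0 !(mulr0, mul0r, scaler0, addr0).
have hG : 'X_r * diag p + c *: p \is m.+2.-homog.
  apply: dhomogD; last exact: dhomogZ.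
  by apply: (dhomogM (d := 1%N)) => //; rewrite dhomogX /= mdeg1.
move=> v; pose t := (dir v (diag p)).@[x] / (m.+1%:R * (diag p).@[x]).
apply: (@log_concave_at_shift _ _ m.+1 _ _ _ t) => //.
  by rewrite mevalD mevalM mevalXU mevalZ addr_ge0 ?mulr_ge0 // ltW.
set w := fun i => _.
have wq : (dir w (diag p)).@[x] = 0.
  rewrite /w (eq_dir _ (w := fun i => v i + (- t) * x i));
    last by move=> i; rewrite mulNr.
  rewrite dirDl dirZl mevalD mevalZ (euler _ hq) mulNr /t divfK ?subrr //.
  by rewrite mulf_neq0 ?pnatr_eq0 // gt_eqF.
move: w wq => w wq.
have wwq : (dir w (dir w (diag p))).@[x] <= 0.
  by have := lq w; rewrite wq expr2 mulr0 pmulr_rle0.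
(* Log-concavity of [p] is used along [w + s (1, ..., 1)]. The mixed term vanishes because [diag p]
   is stationary along [w], and [s] is then chosen to annihilate the first derivative of [p]. *)
have wwp : (dir w (dir w p)).@[x] <= 0.
  have H s : p.@[x] * ((dir w (dir w p)).@[x] + s * (s * (diag (diag p)).@[x]))
      <= ((dir w p).@[x] + s * (diag p).@[x]) ^+ 2.
    have := lp (fun i => w i + s * 1).
    rewrite !dirDl !dirZl !dirD !dirZ /diag (dir_comm (fun _ => 1) w) -/diag.
    rewrite !(mevalD, mevalZ) (_ : (dir w (dir (fun=> 1) p)).@[x] = 0) //.
    by rewrite mulr0 add0r addr0.
  move: (H (- (dir w p).@[x] / (diag p).@[x])) px qx qqx.
  move: (dir w (dir w p)).@[x] (dir w p).@[x] p.@[x] (diag p).@[x].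
  move: (diag (diag p)).@[x] => C B A P Q {}H P0 Q0 C0.
  have Qn : Q != 0 by rewrite gt_eqF.
  move: H; rewrite divfK // addrN expr0n /= pmulr_rle0 // mulrA -expr2.
  by apply: le_trans; rewrite lerDl mulr_ge0 ?sqr_ge0.
rewrite !dirD !dirM !dirZ !dirXU dirD !dirM !dirXU dirC mul0r add0r.
rewrite !(mevalD, mevalM, mevalZ, mevalC, mevalXU) wq !mulr0 !add0r.
by apply: ler_wnDl; [apply: mulr_ge0_le0 wwq; apply: ltW | apply: mulr_ge0_le0].
Qed.

(** The iterate of order 0 falls under [log_concave_at_mulX], those of order 1 to [N] under
    [log_concave_at_mulXD], and the later ones are multiples of iterates of [p]. *)
Lemma diag_log_concave_mulX U r p :
  (forall x, U x -> 0 < x r) -> diag_log_concave U p ->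
  diag_log_concave U ('X_r * p).
Proof.
move=> Ur [N [m [hp pos nul lc]]]; exists N.+1, m.+1; split.
- by rewrite -add1n; apply: dhomogM => //; rewrite dhomogX /= mdeg1.
- move=> [|k] x Ux kN; rewrite iter_diag_mulX mevalD mevalM mevalXU mevalZ.
    by rewrite mul0r addr0; apply: mulr_gt0; [apply: Ur|apply: pos].
  rewrite addrC; apply: ltr_pwDl; first by rewrite mulr_gt0 ?ltr0n // pos.
  apply: mulr_ge0; first exact/ltW/Ur.
  by apply: (@diag_log_concave_ge0 U); [exists N, m|].
- move=> [|k] x // kN.
  rewrite iter_diag_mulX mevalD mevalM mevalZ !nul ?mulr0 ?addr0 //.
  exact: ltnW.
move=> [|k] x Ux; rewrite iter_diag_mulX.
  by rewrite scale0r addr0; apply/log_concave_at_mulX/(lc 0%N).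
have [kN|Nk] := ltnP k N.
  apply: (log_concave_at_mulXD (iter_diag_homog k hp)) => //; rewrite -?iterS.
  - exact: Ur.
  - by apply: pos => //; apply: ltnW.
  - exact: pos.
  - by apply: (@diag_log_concave_ge0 U); [exists N, m|].
  - exact: lc.
  - exact: lc.
have z0 : forall v, (dir v (iter k.+1 diag p)).@[x] = 0.
  move=> v; apply: (@dir_vanish _ _ r r) => // y _; exact: nul.
have z1 : forall v, (dir v (dir v (iter k.+1 diag p))).@[x] = 0.
  move=> v; apply: (@dir_vanish _ _ r r) => // y _.
  by apply: (@dir_vanish _ _ r r) => // {}y _; apply: nul.
move=> v; have := @log_concave_atZ _ _ k.+1%:R _ _ (lc k x Ux) v.
rewrite !dirD !dirM !dirXU dirD !dirM !dirXU dirC mul0r add0r.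
rewrite !(mevalD, mevalM, mevalC, mevalXU) z0 z1.
by rewrite (nul k.+1) // !mulr0 !add0r.
Qed.

(** Each iterate of [diag] on [p] is the integral from [x s] to [x r] of the same iterate on the
    derivative of [p], because [diag] commutes with derivatives and preserves vanishing at
    [x r = x s]. The endpoint [y = x r] may lie outside [U], so log-concavity is shown for [y < x r]
    first and then passes to the limit. *)
Lemma diag_log_concave_integral U V m r s p : s != r -> p \is m.-homog ->
  (forall x, x r = x s -> p.@[x] = 0) ->
  (forall x, V x -> x s < x r) ->
  (forall x y, V x -> x s <= y < x r -> U (upd x r y)) ->
  diag_log_concave U p^`M(r) -> diag_log_concave V p.
Proof.
move=> sr hp p0 Vsr VU Ud.
have rs x y : upd x r y s = x s by rewrite /upd (negbTE sr).
have {Ud} [N [_ [_ pos nul lc]]] := Ud.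
pose P k := iter k diag p; have P0 k := @iter_diag_vanish k _ _ _ p0.
have gt0 k x y : V x -> (k <= N)%N -> x s < y <= x r -> 0 < (P k).@[upd x r y].
  move=> Vx kN /andP[sy yr]; rewrite -horner_coord_line.
  have <- : (coord_line (P k) x r).[x s] = 0.
    by rewrite horner_coord_line P0 // /upd eqxx (negbTE sr).
  apply: horner_gt_incr => // t /andP[st ty].
  rewrite deriv_coord_line horner_coord_line -iter_diag_mderiv pos //.
  by apply: VU => //; rewrite ltW //= (lt_le_trans ty).
have eq0 k x : (N < k)%N -> (P k).@[x] = 0.
  move=> Nk; have d0 : (coord_line (P k) x r)^`() = 0.
    apply: horner_eq0 => t.
    by rewrite deriv_coord_line horner_coord_line -iter_diag_mderiv nul.
  have Ps : (coord_line (P k) x r).[x s] = 0.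
    by rewrite horner_coord_line P0 // /upd eqxx (negbTE sr).
  rewrite -(meval_eq _ (upd_id x r)) -horner_coord_line -Ps.
  have [lt|lt|->//] := ltgtP (x s) (x r).
    have [c _] := poly_mvt (coord_line (P k) x r) lt.
    by rewrite d0 horner0 mul0r => /eqP; rewrite subr_eq0 => /eqP.
  have [c _] := poly_mvt (coord_line (P k) x r) lt.
  by rewrite d0 horner0 mul0r => /eqP; rewrite subr_eq0 => /eqP.
exists N, m; split=> //.
  move=> k x Vx kN; rewrite -(meval_eq _ (upd_id x r)).
  by apply: gt0 => //; rewrite Vsr /=.
move=> k x Vx; have [kN|Nk] := leqP k N; last first.
  by move=> v; rewrite eq0 // mul0r sqr_ge0.
have open y : x s < y < x r -> log_concave_at (P k) (upd x r y).
  move=> /andP[sy yr]; have yE : upd x r y r = y by rewrite /upd eqxx.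
  apply: (log_concave_at_integral sr (iter_diag_homog k hp) (P0 k)); rewrite ?rs ?yE //.
    by apply: gt0 => //; rewrite sy ltW.
  move=> z /andP[sz zy]; have Uz : U (upd x r z).
    by apply: VU => //; rewrite sz (le_lt_trans zy).
  rewrite -iter_diag_mderiv (meval_eq _ (upd_upd x r y z)); split; first exact: pos.
  apply: eq_log_concave_at (lc _ _ Uz) => i; by rewrite upd_upd.
move=> v; pose L q := coord_line q x r.
pose F := L (dir v (P k)) ^+ 2 - L (P k) * L (dir v (dir v (P k))).
have FE y : F.[y] = (dir v (P k)).@[upd x r y] ^+ 2 -
    (P k).@[upd x r y] * (dir v (dir v (P k))).@[upd x r y].
  by rewrite !(hornerD, hornerN, hornerM, horner_exp) !horner_coord_line.
have : 0 <= F.[x r].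
  apply: (@horner_ge0_lim _ _ (x s)); first exact: Vsr.
  by move=> y yab; rewrite FE subr_ge0; apply: open.
by rewrite FE !(meval_eq _ (upd_id x r)) subr_ge0.
Qed.

End DiagLogConcave.

(** * Alternants *)

Section DetLemmas.

(** Expansion along column [q] leaves a single cofactor, in which row [q] is deleted. *)
Lemma det_eq_off_row (R : comNzRingType) (k : nat) (A B : 'M[R]_k) (q : 'I_k) :
  (forall i, A i q = (i == q)%:R) -> (forall i, B i q = (i == q)%:R) ->
  (forall i j, i != q -> A i j = B i j) -> \det A = \det B.
Proof.
move=> Aq Bq AB; rewrite (expand_det_col A q) (expand_det_col B q).
apply: eq_bigr => i _; rewrite Aq Bq; case: eqP => [->|_]; last by rewrite !mul0r.
congr (_ * (_ * \det _)); apply/matrixP => a b; rewrite !mxE AB //.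
by rewrite eq_sym neq_lift.
Qed.

Context (n : nat) (R : comNzRingType).

Lemma mderiv_prod_eq0 (I : Type) (s : seq I) (P : pred I) (F : I -> {mpoly R[n]}) r :
  (forall i, P i -> (F i)^`M(r) = 0) -> (\prod_(i <- s | P i) F i)^`M(r) = 0.
Proof.
move=> F0; elim/big_rec: _ => [|i p Pi p0]; first by rewrite -mpolyC1 mderivC.
by rewrite mderivM F0 // p0 mul0r mulr0 addr0.
Qed.

Lemma mderiv_det_row (k : nat) (A B : 'M[{mpoly R[n]}]_k) i0 r :
  (forall i j, i != i0 -> (A i j)^`M(r) = 0) ->
  (forall j, (A i0 j)^`M(r) = B i0 j) ->
  (forall i j, i != i0 -> A i j = B i j) -> (\det A)^`M(r) = \det B.
Proof.
move=> A0 Ai0 AB; rewrite /determinant linear_sum; apply: eq_bigr => s _ /=.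
have H : (\prod_i A i (s i))^`M(r) = \prod_i B i (s i).
  rewrite (bigD1 i0) //= [RHS](bigD1 i0) //= mderivM.
  rewrite mderiv_prod_eq0 => [|i /A0 //]; rewrite mulr0 addr0 Ai0.
  by congr (_ * _); apply: eq_bigr => i /AB.
by rewrite !mulr_sign; case: (odd_perm s); rewrite ?mderivN H.
Qed.

Lemma mderivXUn i r k :
  ('X_i ^+ k : {mpoly R[n]})^`M(r) = (k * (i == r))%:R *: 'X_i ^+ k.-1.
Proof.
have XU : ('X_i : {mpoly R[n]})^`M(r) = (i == r)%:R%:MP by rewrite -dir_delta dirXU.
elim: k => [|k IH]; first by rewrite expr0 -mpolyC1 mderivC mul0n scale0r.
rewrite exprS mderivM XU IH -scalerAr mul_mpolyC /=; case: (i == r); last first.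
  by rewrite !muln0 !scale0r addr0.
rewrite !muln1 scale1r; case: k {IH} => [|k]; first by rewrite scale0r addr0 scale1r.
by rewrite -exprS /= -[in RHS]natr1 [in RHS]scalerDl scale1r addrC.
Qed.

End DetLemmas.

Section Alternant.
Context (n : nat) (R : rcfType).
Implicit Types (l : nat -> nat) (q r : nat) (x : 'I_n -> R).

(** The alternant in the variables of index at least [q], padded by an identity block so that the
    number of active variables can drop within one polynomial ring. *)
Definition alternant q l : {mpoly R[n]} :=
  \det (\matrix_(i, j) if (i < q)%N || (j < q)%N then (i == j)%:R
                       else 'X_i ^+ l j).

(* The rows of index > r are differentiated. *)
Definition diff_alternant q r l : {mpoly R[n]} :=
  \det (\matrix_(i, j) if (i < q)%N || (j < q)%N then (i == j)%:R
                       else if (i <= r)%N then 'X_i ^+ l j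
                       else (l j)%:R *: 'X_i ^+ (l j).-1).

Lemma alternantE q l : alternant q l = diff_alternant q n.-1 l.
Proof.
congr (\det _); apply/matrixP => i j; rewrite !mxE; case: ifP => // _.
by rewrite -ltnS prednK ?ltn_ord // (leq_trans _ (ltn_ord i)).
Qed.

Lemma mderiv_diff_alternant q (r : 'I_n) l : (q < r)%N ->
  (diff_alternant q r l)^`M(r) = diff_alternant q r.-1 l.
Proof.
move=> qr.
apply: (@mderiv_det_row _ _ _ _ _ r) => [i j ir|j|i j ir]; rewrite !mxE.
- case: ifP => _; first by rewrite -mpolyC_nat mderivC.
  case: ifP => _; first by rewrite mderivXUn (negbTE ir) muln0 scale0r.
  by rewrite mderivZ mderivXUn (negbTE ir) muln0 scale0r scaler0.
- case: ifP => [rj|_].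
    rewrite -mpolyC_nat mderivC (_ : (r == j) = false) // -val_eqE /=.
    by apply/eqP => E; move: rj; rewrite -E; lia.
  by rewrite leqnn leqNgt prednK ?leqnn ?mderivXUn ?eqxx ?muln1 //; lia.
- case: ifP => // _; have -> // : (i <= r)%N = (i <= r.-1)%N.
  by move: ir; rewrite -val_eqE /=; lia.
Qed.

Lemma alternant_homog q l : exists m, alternant q l \is m.-homog.
Proof.
pose d (j : 'I_n) := if (j < q)%N then 0%N else l j.
exists (\sum_j d j)%N; rewrite /alternant /determinant; apply: rpred_sum => s _.
rewrite mulr_sign; set p := \prod_i _.
suff hp : p \is (\sum_j d j)%N.-homog by case: ifP => _; rewrite ?rpredN.
rewrite (reindex_inj (@perm_inj _ s)) /p /=.
elim/big_rec2: _ => [|i p' e _ IH]; first exact: dhomog1.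
apply: dhomogM => //; rewrite mxE /d; case: (ltnP (s i) q) => siq.
  by rewrite orbT; case: (_ == _); [apply: dhomog1|apply: dhomog0].
rewrite orbF; case: ifP => iq.
  rewrite (_ : (i == s i) = false); first exact: dhomog0.
  by apply: contraTF iq => /eqP ->; rewrite -leqNgt.
elim: (l _) => [|k IHk]; first by rewrite expr0 dhomog1.
by rewrite exprS -add1n; apply: dhomogM => //; rewrite dhomogX /= mdeg1.
Qed.

(** Descending induction from [r = n.-1], the alternant itself: each step is a partial
    derivative. *)
Lemma diff_alternant_homog q r l : (q <= r < n)%N ->
  exists m, diff_alternant q r l \is m.-homog.
Proof.
move=> /andP[qr rn]; rewrite -(subKn (n:=n.-1) (m:=r)); last by lia.
have : (n.-1 - r <= n.-1 - q)%N by lia.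
elim: (n.-1 - r)%N => [|k IH] kq.
  by rewrite subn0 -alternantE; apply: alternant_homog.
have [|m hm] := IH; first by lia.
have rk : (n.-1 - k < n)%N by lia.
exists m.-1; have := mderiv_homog (Ordinal rk) hm.
rewrite (@mderiv_diff_alternant q (Ordinal rk)) /=; last by lia.
by rewrite subnS.
Qed.

Lemma diff_alternant_vanish q (r s : 'I_n) l x :
  (q <= s)%N -> (q <= r)%N -> (s < r)%N ->
  x r = x s -> (diff_alternant q r l).@[x] = 0.
Proof.
move=> qs qr sr xrs; rewrite -[LHS](det_map_mx (meval x)).
apply: (@determinant_alternate _ _ _ r s) => [|j]; first by rewrite -val_eqE gtn_eqF.
rewrite !mxE !ltnNge qs qr /=; case: ifP => jq.
  case: eqP => [rj|_]; first by move: jq; rewrite -rj qr.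
  by case: eqP => // sj; move: jq; rewrite -sj qs.
by rewrite leqnn (ltnW sr) !rmorphXn /= !mevalXU xrs.
Qed.

(** Since [l q = 0], column [q] has 1 in row [q] and derivatives of constants below it. The factors
    [l j] come out of the columns [j > q], and [c] is their product. *)
Lemma diff_alternant_first q l : (q < n)%N -> l q = 0%N ->
  (forall j, q < j -> 0 < l j)%N ->
  exists2 c, 0 < c & diff_alternant q q l = c *: alternant q.+1 (fun j => (l j).-1).
Proof.
move=> qn lq lpos; exists (\prod_(j < n) if (j <= q)%N then 1 else (l j)%:R).
  by apply: prodr_gt0 => j _; case: ifP => // /negbT; rewrite -ltnNge ltr0n => /lpos.
pose d : 'rV[{mpoly R[n]}]_n := \row_j if (j <= q)%N then 1 else (l j)%:R.
pose M : 'M[{mpoly R[n]}]_n := \matrix_(i, j)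
  if (i < q.+1)%N || (j < q.+1)%N then (i == j)%:R else 'X_i ^+ (l j).-1.
have ME i j : (M *m diag_mx d) i j = M i j * d 0 j.
  by rewrite mul_mx_diag mxE.
transitivity (\det (M *m diag_mx d)); last first.
  rewrite det_mulmx det_diag mulrC -mul_mpolyC rmorph_prod; congr (_ * _).
  apply: eq_bigr => j _; rewrite mxE; case: ifP => _; first by rewrite rmorph1.
  by rewrite rmorph_nat.
apply: (@det_eq_off_row _ _ _ _ (Ordinal qn)) => [i|i|i j iq].
- rewrite !mxE /= ltnn orbF lq -[i == _]val_eqE /=.
  by case: ltngtP => // _; rewrite ?scale0r ?expr0.
- by rewrite ME !mxE /= leqnn ltnS leqnn orbT mulr1.
- rewrite ME !mxE !ltnS; move: iq; rewrite -val_eqE /= => iq.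
  rewrite [(i <= q)%N]leq_eqVlt (negbTE iq) /=.
  case: ltnP => [ij|qi] /=.
    by case: eqP => [<-|_]; rewrite ?(ltnW ij) ?mulr1 ?mul0r.
  have [jq|qj|jq] := ltngtP j q.
  - by rewrite mulr1.
  - by rewrite mulr_natr scaler_nat.
  - have -> : j = Ordinal qn by apply: val_inj.
    by rewrite /= lq scale0r -val_eqE /= (negbTE iq) mul0r.
Qed.

Lemma alternant_mulX q l : (forall j, q <= j -> 0 < l j)%N ->
  alternant q l =
  (\prod_(i < n | (q <= i)%N) 'X_i) * alternant q (fun j => (l j).-1).
Proof.
move=> lpos; pose d : 'rV[{mpoly R[n]}]_n := \row_i if (q <= i)%N then 'X_i else 1.
transitivity (\det (diag_mx d) * alternant q (fun j => (l j).-1)); last first.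
  rewrite det_diag [in RHS]big_mkcond; congr (_ * _).
  by apply: eq_bigr => i _; rewrite mxE.
rewrite -det_mulmx; congr (\det _); apply/matrixP => i j.
rewrite mul_diag_mx !mxE ltnNge; case: (leqP q i) => /= qi; last by rewrite mul1r.
case: ltnP => jq; last by rewrite -exprS prednK // lpos.
by rewrite (_ : (i == j) = false) ?mulr0 // -val_eqE gtn_eqF // (leq_trans jq).
Qed.

Definition increasing_from q x := forall i j : 'I_n, (q <= i)%N ->
  0 < x i /\ ((i < j)%N -> x i < x j).

(** Induction on the number [n - q] of variables and, inside it, on the least exponent [l q]. A
    positive [l q] is lowered by factoring out the variables; for [l q = 0] the differentiated rows
    are integrated one after another, starting from an alternant in one variable less. *)
Lemma alternant_diag_log_concave q l : (q <= n)%N ->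
  (forall i j, q <= i -> i < j -> l i < l j)%N ->
  diag_log_concave (increasing_from q) (alternant q l).
Proof.
move=> qn; rewrite -(subKn qn); move: (n - q)%N (leq_subr q n) => k {q qn}.
elim: k l => [|k IHk] l kn lmono.
  rewrite subn0 (_ : alternant n l = 1); first exact: diag_log_concave1.
  rewrite -(det1 _ n); congr (\det _); apply/matrixP => i j.
  by rewrite !mxE ltn_ord.
set q := (n - k.+1)%N in lmono *; have qn : (q < n)%N by rewrite /q; lia.
have q1 : (n - k)%N = q.+1 by rewrite /q; lia.
have {}IHk l' : (forall i j, q < i -> i < j -> l' i < l' j)%N ->
    diag_log_concave (increasing_from q.+1) (alternant q.+1 l').
  by rewrite -q1; apply: IHk; lia.
move: {2}(l q) (erefl (l q)) => m; elim: m l lmono => [|m IHm] l lmono lq; last first.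
  have lpos j : (q <= j -> 0 < l j)%N.
    rewrite leq_eqVlt => /predU1P[<-|qj]; first by rewrite lq.
    by rewrite (leq_ltn_trans _ (lmono q j _ qj)).
  rewrite alternant_mulX //; elim/big_rec: _ => [|i p qi IHp].
    rewrite mul1r; apply: IHm; last by rewrite lq.
    by move=> i j qi ij; have := lpos _ qi; have := lmono _ _ qi ij; lia.
  by rewrite -mulrA; apply: diag_log_concave_mulX IHp => x /(_ i i qi) [].
(* Coordinate [r.+1] will be integrated upwards from coordinate [r], so the two may coincide at the
   start; only this pair gets a weak inequality. *)
pose V r x := forall i j : 'I_n, (q <= i)%N -> 0 < x i /\ ((i < j)%N ->
  x i < x j \/ [/\ i = r :> nat, j = r.+1 :> nat & x i <= x j]).
suff H r : (q <= r < n)%N -> diag_log_concave (V r) (diff_alternant q r l).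
  rewrite alternantE; apply: diag_log_concave_sub (H n.-1 _); last by lia.
  by move=> x Ux i j qi; have [xi xij] := Ux i j qi; split=> // ij; left; apply: xij.
move=> /andP[qr]; rewrite -(subnKC qr); elim: (r - q)%N => {r qr} [|r IHr] rn.
  rewrite addn0; have [|c c0 ->] := diff_alternant_first qn lq.
    by move=> j qj; rewrite (leq_ltn_trans _ (lmono q j _ qj)).
  apply: diag_log_concaveZ => //; apply: diag_log_concave_sub (IHk _ _).
    move=> x Vx i j qi; have [xi xij] := Vx i j (ltnW qi); split=> // ij.
    by have [//|[iq]] := xij ij; move: qi; rewrite iq ltnn.
  move=> i j qi ij; have := lmono _ _ (ltnW qi) ij.
  by have := lmono q i (leqnn _) qi; lia.
have rn' : (q + r < n)%N by lia.
pose r1 : 'I_n := Ordinal rn; pose s1 : 'I_n := Ordinal rn'.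
have [|m hm] := @diff_alternant_homog q (q + r.+1) l; first by lia.
have sr : s1 != r1 by rewrite -val_eqE /=; lia.
have Vsr x : V (q + r.+1)%N x -> x s1 < x r1.
  move=> Vx; have [|_ /=] := Vx s1 r1; first by rewrite /=; lia.
  by case; [lia| |case] => //=; lia.
apply: (@diag_log_concave_integral _ _ (V (q + r)%N) _ _ r1 s1 _ sr hm).
- move=> x; apply: (@diff_alternant_vanish q r1 s1); rewrite /=; lia.
- exact: Vsr.
- move=> x y Vx /andP[sy yr] i j qi.
  have [s0 _] : 0 < x s1 /\ _ := Vx s1 s1 (leq_addr _ _).
  split.
    by rewrite /upd; case: eqP => _; [apply: lt_le_trans sy|case: (Vx i i qi)].
  move=> ij; rewrite /upd; case: eqP => [ir|ir]; case: eqP => [jr|jr].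
  + by move: ij; rewrite ir jr ltnn.
  (* The strict bound [y < x r1] makes up for the weak inequality between [r1] and its successor. *)
  + left; apply: lt_le_trans yr _; have [_ H] := Vx r1 j (leq_addr _ _).
    by rewrite ir in ij; case: (H ij) => [/ltW|[]].
  + have [is1|is1] := eqVneq i s1; first by right; rewrite is1 jr /= addnS.
    left; apply: lt_le_trans sy; have [_ H] := Vx i s1 qi.
    have [| //|[]] := H; last by rewrite /=; lia.
    by move: ij is1; rewrite jr -val_eqE /=; lia.
  + left; have [_ H] := Vx i j qi; have [//|[ir' _ _]] := H ij.
    by case: ir; apply: val_inj.
- rewrite mderiv_diff_alternant /=; last by lia.
  by rewrite addnS; apply: IHr; lia.
Qed.

End Alternant.

(** * The Schur polynomial as a quotient of alternants *)

Section JacobiTrudi.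

Lemma det_rev_ord (R : comNzRingType) k (A : 'M[R]_k) :
  \det (\matrix_(i, j) A (rev_ord i) (rev_ord j)) = \det A.
Proof.
pose s := perm (@rev_ord_inj k).
have -> : (\matrix_(i, j) A (rev_ord i) (rev_ord j)) = row_perm s (col_perm s A).
  by apply/matrixP => i j; rewrite !mxE !permE.
rewrite row_permE col_permE !det_mulmx !det_perm odd_permV mulrCA mulrA.
by rewrite -mulrA -signr_addb addbb mulr1.
Qed.

Definition unit_rows (R : comNzRingType) N n (rho : nat -> nat)
    (g : nat -> nat -> R) : 'M[R]_(N + n) :=
  \matrix_(a, j) if (a < N)%N then (j == a + rho a :> nat)%N%:R
                 else g (a - N)%N j.

(** Expansion along the unit rows, one at a time: [psi] enumerates the columns not of the form
    [a + rho a], and [bump] restores the column numbers after each deletion. The choice of [psi]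
    does not depend on [g]. *)
Lemma det_unit_rows N n (rho : nat -> nat) :
  (forall i j, i <= j < N -> rho i <= rho j)%N ->
  (forall i, i < N -> rho i <= n)%N ->
  exists psi : nat -> nat, [/\ {homo psi : i j / (i < j)%N},
    forall j, (j < n -> psi j < N + n)%N &
    forall (R : comNzRingType) (g : nat -> nat -> R),
      \det (unit_rows N n rho g) =
      (-1) ^+ (\sum_(i < N) rho i) * \det (\matrix_(i < n, j < n) g i (psi j))].
Proof.
elim: N rho => [|N IH] rho mono rhon.
  exists id; split=> // R g; rewrite big_ord0 mul1r; congr (\det _).
  by apply/matrixP => i j; rewrite !mxE subn0.
have [||psi [psi_homo psi_lt IHd]] := IH (fun i => rho i.+1).
- by move=> i j ij; apply: mono; lia.
- by move=> i iN; apply: rhon; lia.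
have bump_homo : {homo bump (rho 0%N) : i j / (i < j)%N}.
  by move=> i j ij; rewrite /bump; case: (leqP _ i) => ?; case: (leqP _ j) => ?; lia.
exists (bump (rho 0%N) \o psi); split.
- by move=> i j /psi_homo /bump_homo.
- by move=> j /psi_lt; rewrite /= /bump; case: (leqP _ (psi j)) => ?; lia.
move=> R g; have r0 : (rho 0%N < N.+1 + n)%N by have := rhon 0%N isT; lia.
rewrite (expand_det_row _ (ord0 : 'I_(N.+1 + n))) (bigD1 (Ordinal r0)) //=.
rewrite big1 ?addr0 => [|j jr]; last first.
  rewrite mxE /= add0n (_ : (j == rho 0%N :> nat) = false) ?mul0r //.
  by rewrite -[RHS](negbTE jr).
rewrite mxE /= eqxx mul1r /cofactor add0n big_ord_recl exprD -mulrA; congr (_ * _).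
rewrite -(IHd _ (fun i k => g i (bump (rho 0%N) k))); congr (\det _).
apply/matrixP => a j; rewrite !mxE /= /bump leq0n add1n ltnS subSS; case: ifP => // aN.
have := mono 0%N a.+1; rewrite ltnS aN => /(_ isT) H.
congr ((_ : bool)%:R); case: (leqP _ j) => jr; rewrite ?add1n ?add0n.
  by rewrite addSn eqSS.
have jH := leq_trans jr H.
by rewrite !ltn_eqF // (leq_trans jH) // leq_addl.
Qed.

Context (n : nat) (R : idomainType).
Implicit Types (la : seq nat) (x : 'I_n -> R).

Lemma schur_eq0 la : (n < nth 0 la 0)%N -> schur n R la = 0.
Proof.
move=> nla; have la0 : (0 < size la)%N.
  by rewrite lt0n; apply: contraTneq nla => /size0nil ->.
rewrite /schur (expand_det_row _ (Ordinal la0)) big1 // => j _.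
rewrite mxE (_ : _ - _ + _ = (nth 0%N la 0 + j)%N%:Z); last by rewrite /=; lia.
by rewrite /= mesym_geqnE ?mul0r // ltn_addr.
Qed.

(** The coefficients of [P] are, up to sign, the elementary symmetric polynomials, and both vanish
    outside the same range. The signs split into row and column factors, of which only those from
    [rho] survive. *)
Lemma det_elem_sym N (rho : nat -> nat) x :
  (forall i, i < N -> rho i <= n)%N ->
  let P := \prod_(i < n) ('X - (x i)%:P) in
  \det (\matrix_(i < N, j < N)
    ('X^(N.-1 - j) * P)`_(N.-1 + n - (i + rho i))) =
  (-1) ^+ (\sum_(i < N) rho i) *
  \det (\matrix_(i < N, j < N)
    (elem_sym n R ((rho i)%:Z + i%:Z - j%:Z)).@[x]).
Proof.
move=> rhon P; pose T := [tuple x i | i < n].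
have PE : P = \prod_(c <- T) ('X - c%:P).
  by rewrite big_tuple; apply: eq_bigr => i _; rewrite tnth_mktuple.
have sP : size P = n.+1.
  by rewrite PE size_prod_XsubC size_tuple.
pose al : 'rV[R]_N := \row_i (-1) ^+ (rho i + i).
pose be : 'rV[R]_N := \row_j (-1) ^+ j.
set S0 := (X in _ = _ * \det X).
transitivity (\det (diag_mx al *m S0 *m diag_mx be)); last first.
  rewrite !det_mulmx !det_diag.
  have -> : \prod_i al 0 i = (-1) ^+ (\sum_(i < N) rho i) * \prod_i be 0 i.
    rewrite -prodrXr -big_split; apply: eq_bigr => i _ /=.
    by rewrite !mxE exprD.
  have BB : (\prod_j be 0 j) * (\prod_j be 0 j) = 1.
    rewrite -big_split big1 // => j _ /=.
    by rewrite !mxE -exprD addnn -mul2n exprM sqrrN expr1n expr1n.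
  by rewrite -!mulrA [X in _ * X = _]mulrCA BB mulr1.
congr (\det _); apply/matrixP => i j; rewrite mul_mx_diag mul_diag_mx !mxE.
rewrite coefXnM; have iN := ltn_ord i; have jN := ltn_ord j; have := rhon i iN => rin.
have [[k kE]|neg] : (exists k : nat, (i + rho i = j + k)%N) \/ (i + rho i < j)%N.
- case: (leqP j (i + rho i)) => H; [left|by right].
  by exists (i + rho i - j)%N; rewrite subnKC.
- have -> : (rho i)%:Z + i%:Z - j%:Z = k%:Z by lia.
  rewrite /= mulrAC -exprD.
  have -> : (-1) ^+ (rho i + i + j) = (-1) ^+ k :> R.
    rewrite (_ : (rho i + i + j = j.*2 + k)%N); last by lia.
    by rewrite exprD -mul2n exprM sqrrN expr1n expr1n mul1r.
  case: ltnP => H.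
    by rewrite mesym_geqnE ?meval0 ?mulr0 //; lia.
  rewrite (_ : (N.-1 + n - (i + rho i) - (N.-1 - j) = n - k)%N); last by lia.
  have kn : (k < n.+1)%N by lia.
  rewrite PE (@mroots_coeff _ _ _ (Ordinal kn)) /=; congr (_ * _).
  by apply: meval_eq => a; rewrite tnth_mktuple.
have -> : elem_sym n R ((rho i)%:Z + i%:Z - j%:Z) = 0.
  have : ((rho i)%:Z + i%:Z - j%:Z < 0) by lia.
  by case: ((rho i)%:Z + i%:Z - j%:Z).
rewrite meval0 mulr0 mul0r; case: ifP => // _.
by rewrite nth_default // sP; lia.
Qed.

(** The bialternant formula, multiplied out so that coinciding [x i] are allowed. The determinant of
    one matrix [B] is computed twice: by expansion along its unit rows, and after multiplication by
    a matrix of determinant 1 that makes it block triangular. *)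
Lemma schur_alternant la : sorted geq la -> (nth 0 la 0 <= n)%N ->
  exists psi : nat -> nat, [/\ {homo psi : i j / (i < j)%N},
    forall j, (j < n -> psi j < size la + n)%N &
    forall x,
    \det (\matrix_(i < n, j < n) x i ^+ (n.-1 - j)) * (schur n R la).@[x] =
    \det (\matrix_(i < n, j < n) x i ^+ ((size la + n).-1 - psi j))].
Proof.
(* [rho] lists the parts in increasing order, as [det_unit_rows] demands; [det_rev_ord] undoes the
   reversal at the end. *)
move=> sla lan; set N := size la; pose rho i := nth 0%N la (N.-1 - i).
have la_mono i j : (i <= j < N)%N -> (nth 0 la j <= nth 0 la i)%N.
  move=> /andP[ij jN]; have geT : transitive geq by move=> a b c ba /leq_trans; apply.
  by apply: (sorted_leq_nth geT leqnn 0%N sla) => //; rewrite inE (leq_ltn_trans ij).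
have rho_mono i j : (i <= j < N)%N -> (rho i <= rho j)%N.
  by move=> ij; apply: la_mono; lia.
have rho_n i : (i < N)%N -> (rho i <= n)%N.
  by move=> iN; apply: leq_trans lan; apply: la_mono; lia.
have [psi [psi_homo psi_lt psi_det]] := det_unit_rows rho_mono rho_n.
exists psi; split=> // x.
pose X k := if insub k is Some i then x i else 0.
have XE (i : 'I_n) : X i = x i by rewrite /X valK.
pose g i j := X i ^+ ((N + n).-1 - j).
pose P := \prod_(i < n) ('X - (x i)%:P).
have mP : P \is monic by apply: monic_prod_XsubC.
have sP : size P = n.+1 by rewrite size_prod_XsubC -sum1_size sum1_card card_ord.
pose basis (j : nat) : {poly R} :=
  if (j < N)%N then 'X^(N.-1 - j) * P else 'X^((N + n).-1 - j).
have basis_monic j : basis j \is monic.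
  by rewrite /basis; case: ifP => _; rewrite ?monicMl ?monicXn.
have size_basis j : (j < N + n)%N -> size (basis j) = (N + n - j)%N.
  move=> jNn; rewrite /basis; case: ifP => jN; last by rewrite size_polyXn; lia.
  rewrite size_monicM ?monicXn ?monic_neq0 // size_polyXn sP; lia.
pose C : 'M[R]_(N + n) := \matrix_(k, j) (basis j)`_((N + n).-1 - k).
have detC : \det C = 1.
  rewrite det_trig; last first.
    apply/is_trig_mxP => k j kj; rewrite mxE nth_default // size_basis //.
    by have := ltn_ord j; lia.
  rewrite big1 // => j _; rewrite mxE.
  have := monicP (basis_monic j); rewrite /lead_coef size_basis ?ltn_ord //.
  by rewrite (_ : (N + n - j).-1 = (N + n).-1 - j)%N //; lia.
(* B evaluates polynomials of degree < N + n at the x_i and extracts N of their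
   coefficients, and C is the unitriangular matrix of the basis X^j P (j < N),
   X^j (j < n): P vanishes at the x_i, and its coefficients are the elementary
   symmetric polynomials. *)
pose B := unit_rows N n rho g.
have BCu (a : 'I_(N + n)) j : (a < N)%N ->
    (B *m C) a j = (basis j)`_((N + n).-1 - (a + rho a)).
  move=> aN; have an : (a + rho a < N + n)%N by have := rho_n a aN; lia.
  rewrite mxE (bigD1 (Ordinal an)) //= big1 => [|k kn]; last first.
    rewrite mxE aN (_ : (k == a + rho a :> nat)%N = false) ?mul0r //.
    by rewrite -[RHS](negbTE kn).
  by rewrite addr0 !mxE aN /= eqxx mul1r.
have BCd (a : 'I_(N + n)) (j : 'I_(N + n)) : (N <= a)%N ->
    (B *m C) a j = (basis j).[X (a - N)%N].
  move=> Na; rewrite (@horner_coef_wide _ (N + n));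
    last by rewrite size_basis ?leq_subr.
  rewrite mxE (reindex_inj rev_ord_inj) /=; apply: eq_bigr => k _.
  have kl := ltn_ord k; rewrite !mxE ltnNge Na /= /g.
  have -> : ((N + n).-1 - (N + n - k.+1) = k)%N by clear -kl; lia.
  by rewrite mulrC.
have detB : \det B = (-1) ^+ (\sum_(i < N) rho i) *
    (\det (\matrix_(i < n, j < n) x i ^+ (n.-1 - j)) * (schur n R la).@[x]).
  rewrite -[LHS]mulr1 -[X in \det B * X]detC -det_mulmx.
  move: (B *m C) BCu BCd => M BCu BCd; rewrite -[M]submxK.
  have -> : dlsubmx M = 0.
    apply/matrixP => i j; rewrite !mxE BCd /= ?leq_addr // /basis ltn_ord.
    rewrite hornerM addKn XE (_ : P.[x i] = 0) ?mulr0 // /P (bigD1 i) //=.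
    by rewrite hornerM hornerXsubC subrr mul0r.
  have -> : drsubmx M = \matrix_(i < n, j < n) x i ^+ (n.-1 - j).
    apply/matrixP => i j; rewrite !mxE BCd /= ?leq_addr // /basis ltnNge leq_addr /=.
    rewrite hornerXn addKn XE; congr (_ ^+ _); have := ltn_ord j; clear; lia.
  have -> : ulsubmx M = \matrix_(i < N, j < N)
      ('X^(N.-1 - j) * P)`_(N.-1 + n - (i + rho i)).
    apply/matrixP => i j; rewrite !mxE BCu /= // /basis ltn_ord.
    by congr (_`_(_ - _)); have := ltn_ord i; clear; lia.
  rewrite det_ublock (det_elem_sym x rho_n) -mulrA; congr (_ * _).
  rewrite mulrC; congr (_ * _); rewrite -[RHS](det_map_mx (meval x)).
  rewrite -[RHS]det_rev_ord; congr (\det _); apply/matrixP => i j; rewrite !mxE.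
  congr ((elem_sym n R _).@[x]); rewrite /= /rho.
  have -> : (N.-1 - i = N - i.+1)%N by clear; lia.
  by have := ltn_ord i; have := ltn_ord j; rewrite -/N; clear; lia.
have c0 : (-1) ^+ (\sum_(i < N) rho i) != 0 :> R by rewrite signr_eq0.
have := psi_det R g; rewrite -/B detB => /(mulfI c0) ->.
by congr (\det _); apply/matrixP => i j; rewrite !mxE /g XE.
Qed.

End JacobiTrudi.

(** * Log-concavity of derived Schur polynomials *)

Section Symmetry.
Context (n : nat) (R : comNzRingType).
Implicit Types (p : {mpoly R[n]}) (x : 'I_n -> R).

Lemma meval_msym (s : 'S_n) p x : (msym s p).@[x] = p.@[x \o s].
Proof.
rewrite [RHS]mevalE /msym /mmap raddf_sum /=; apply: eq_bigr => m _.
rewrite mevalM mevalC; congr (_ * _); rewrite /mmap1 rmorph_prod /=.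
by apply: eq_bigr => i _; rewrite rmorphXn /= mevalXU.
Qed.

Lemma meval_schur_perm (s : 'S_n) la x :
  (schur n R la).@[x \o s] = (schur n R la).@[x].
Proof.
rewrite /schur -!(det_map_mx (meval _)); congr (\det _).
apply/matrixP => i j; rewrite !mxE /elem_sym /=; case: (_ + _) => [k|k];
  last by rewrite !meval0.
by rewrite -meval_msym; congr meval; apply/issymP/mesym_sym.
Qed.

End Symmetry.

Section SchurDerived.
Context (n : nat) (R : rcfType).
Implicit Types (la : seq nat) (p : {mpoly R[n]}) (x y : 'I_n -> R).

Lemma line_translate p x :
  map_poly (meval x) (translate p) = line p x (fun _ => 1).
Proof.
apply: horner_ext => t; rewrite -meval_translate horner_line.
by apply/meval_eq => i; rewrite mul1r.
Qed.

Lemma coef_line k p x v : (line p x v)`_k * (k`!)%:R = (iter k (dir v) p).@[x].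
Proof.
have dE : (line p x v)^`(k) = line (iter k (dir v) p) x v.
  by elim: k => // k IH; rewrite derivnS IH deriv_line.
have := coef_derivn k (line p x v) 0.
rewrite dE addn0 ffactnn mulr_natr => <-; rewrite -horner_coef0 horner_line.
by apply: meval_eq => i; rewrite mulr0 addr0.
Qed.

Lemma schur_derivedE la (k : nat) x :
  (schur_derived n R la k).@[x] * (k`!)%:R = (iter k (@diag n R) (schur n R la)).@[x].
Proof.
rewrite -coef_line -line_translate coef_map /=; congr (_ * _).
case: leqP => // H; rewrite nth_default //.
by apply: leq_trans (size_translate_schur _ _ _) _.
Qed.

(** The direction (1, ..., 1) is fixed by permutations, so the symmetry of the Schur polynomial
    passes to its restrictions to diagonal lines. *)
Lemma iter_diag_schur_perm (s : 'S_n) la k x :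
  (iter k (@diag n R) (schur n R la)).@[x \o s] =
  (iter k (@diag n R) (schur n R la)).@[x].
Proof.
have LE : line (schur n R la) (x \o s) (fun _ => 1) =
    line (schur n R la) x (fun _ => 1).
  apply: horner_ext => t; rewrite !horner_line -[RHS](meval_schur_perm s).
  exact: meval_eq.
by rewrite -!coef_line LE.
Qed.

Lemma sort_perm x : exists s : 'S_n, forall i j : 'I_n, (i < j)%N -> x (s j) <= x (s i).
Proof.
pose t := [tuple x i | i < n]; pose u := sort >=%O t.
have /tuple_permP[s us] : perm_eq u t by rewrite perm_sort.
exists s => i j ij.
have su : sorted >=%O u by apply: sort_sorted => a b; apply: ge_total.
have ux (k : 'I_n) : nth 0 u k = x (s k).
  by rewrite us -tnth_nth !tnth_mktuple.
have geT : transitive (>=%O : rel R) by move=> a b c ba /le_trans; apply.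
rewrite -!ux; apply: (sorted_leq_nth geT (@lexx _ R) 0 su) (ltnW ij);
  by rewrite inE size_sort size_tuple.
Qed.

Lemma meval_alternant0 l y :
  (alternant n R 0 l).@[y] = \det (\matrix_(i < n, j < n) y i ^+ l j).
Proof.
rewrite -[LHS](det_map_mx (meval y)); congr (\det _).
by apply/matrixP => i j; rewrite !mxE /= rmorphXn /= mevalXU.
Qed.

(** Only non-strict conditions at a single point, which survive limits to the boundary of the
    chamber. *)
Definition diag_log_concave_at p x := forall k,
  0 <= (iter k (@diag n R) p).@[x] /\
  (iter k (@diag n R) p).@[x] * (iter k.+2 (@diag n R) p).@[x]
    <= (iter k.+1 (@diag n R) p).@[x] ^+ 2.

(** The Vandermonde determinant is a positive constant along the diagonal line through [x]. Unless
    the Schur polynomial is zero, its product with this constant is an alternant on that line, and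
    the derivatives of all orders can be compared. *)
Lemma schur_diag_log_concave_decreasing la x : is_partition la ->
  (forall i, 0 < x i) -> (forall i j : 'I_n, (i < j)%N -> x j < x i) ->
  diag_log_concave_at (schur n R la) x.
Proof.
move=> /andP[sla _] x0 xdec.
have [lan|nla] := leqP (nth 0%N la 0) n; last first.
  move=> k; suff d0 j : iter j (@diag n R) (schur n R la) = 0.
    by rewrite !d0 meval0 mul0r expr2 mul0r.
  by rewrite (schur_eq0 _ nla); elim: j => //= j ->; rewrite /diag dir0.
have [psi [psi_homo psi_lt sE]] := schur_alternant R sla lan.
set N := size la in psi_lt sE.
(* The exponents in increasing order; the values from [n] on keep [l] strictly increasing on all
   natural numbers. *)
pose l j := if (j < n)%N then ((N + n).-1 - psi (n.-1 - j))%N else (N + n + j)%N.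
have l_mono i j : (0 <= i -> i < j -> l i < l j)%N.
  move=> _ ij; rewrite /l; case: (ltnP j n) => jn; last by case: ifP => _; lia.
  rewrite (ltn_trans ij jn); have := psi_homo (n.-1 - j)%N (n.-1 - i)%N.
  by have := psi_lt (n.-1 - i)%N; lia.
have rev_dec (z : 'I_n -> R) (E : nat -> nat) (E' : nat -> nat) :
    (forall j : 'I_n, E' j = E (rev_ord j)) ->
    \det (\matrix_(i < n, j < n) (z \o @rev_ord n) i ^+ E' j) =
    \det (\matrix_(i < n, j < n) z i ^+ E j).
  move=> EE; rewrite -[RHS]det_rev_ord; congr (\det _).
  by apply/matrixP => i j; rewrite !mxE EE.
pose y := x \o @rev_ord n.
pose Dl : R := \det (\matrix_(i < n, j < n) x i ^+ (n.-1 - j)).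
have DlE t : \det (\matrix_(i < n, j < n) (x i + t) ^+ (n.-1 - j)) =
    \prod_(i < n) \prod_(j < n | (i < j)%N) (y j - y i).
  rewrite -(rev_dec (fun i => x i + t) (fun j => n.-1 - j)%N id) => [|j]; last first.
    by rewrite /=; have := ltn_ord j; lia.
  rewrite -det_tr; transitivity (\det (Vandermonde n (\row_i (y i + t)))).
    by congr (\det _); apply/matrixP => i j; rewrite !mxE.
  rewrite det_Vandermonde; apply: eq_bigr => i _; apply: eq_bigr => j _.
  by rewrite !mxE opprD addrACA subrr addr0.
have yinc : increasing_from 0 y.
  move=> i j _; split; first exact: x0.
  by move=> ij; apply: xdec; rewrite /=; have := ltn_ord j; lia.
have Dl0 : 0 < Dl.
  have <- : \det (\matrix_(i < n, j < n) (x i + 0) ^+ (n.-1 - j)) = Dl.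
    by congr (\det _); apply/matrixP => i j; rewrite !mxE addr0.
  rewrite DlE; apply: prodr_gt0 => i _; apply: prodr_gt0 => j ij.
  by rewrite subr_gt0; apply: (yinc i j _).2.
have DlT t : \det (\matrix_(i < n, j < n) (x i + t) ^+ (n.-1 - j)) = Dl.
  rewrite DlE -(DlE 0); congr (\det _).
  by apply/matrixP => i j; rewrite !mxE addr0.
have LE : Dl *: line (schur n R la) x (fun _ => 1) =
    line (alternant n R 0 l) y (fun _ => 1).
  apply: horner_ext => t.
  rewrite hornerZ !horner_line meval_alternant0 -(DlT (1 * t)) sE.
  rewrite -(rev_dec (fun i => x i + 1 * t) (fun j => (N + n).-1 - psi j)%N l) //.
  move=> j; rewrite /l ltn_ord /=; congr (_ - psi _)%N; have := ltn_ord j; lia.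
have SE k : Dl * (iter k (@diag n R) (schur n R la)).@[x] =
    (iter k (@diag n R) (alternant n R 0 l)).@[y].
  by rewrite -!coef_line mulrA -coefZ LE.
have nl := alternant_diag_log_concave R (leq0n n) l_mono.
move=> k; split.
  by rewrite -(pmulr_rge0 _ Dl0) SE; apply: diag_log_concave_ge0 yinc.
have [_ [_ [_ _ _ /(_ k y yinc) /(_ (fun _ => 1))]]] := nl.
rewrite -/(diag _) -/(diag (diag _)) -!iterS -!SE mulrACA exprMn.
by rewrite -expr2 ler_pM2l ?exprn_gt0.
Qed.

Lemma schur_diag_log_concave la x : is_partition la -> (forall i, 0 <= x i) ->
  diag_log_concave_at (schur n R la) x.
Proof.
move=> hla x0; have [s xs] := sort_perm x.
suff H : diag_log_concave_at (schur n R la) (x \o s).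
  by move=> k; have := H k; rewrite !iter_diag_schur_perm.
(* Moving the sorted point along this positive, strictly decreasing vector makes it positive and
   strictly decreasing for every [t > 0]; then [t] tends to 0. *)
pose v (i : 'I_n) : R := (n - i)%:R.
have near (t : R) : 0 < t ->
    diag_log_concave_at (schur n R la) (fun i => (x \o s) i + v i * t).
  move=> t0; apply: schur_diag_log_concave_decreasing => // [i|i j ij].
    by rewrite ltr_wpDl ?x0 // mulr_gt0 ?ltr0n ?subn_gt0.
  by rewrite ler_ltD ?xs // ltr_pM2r // ltr_nat; have := ltn_ord j; lia.
have line0 q : (line q (x \o s) v).[0] = q.@[x \o s].
  by rewrite horner_line; apply: meval_eq => i; rewrite mulr0 addr0.
move=> k; pose S j := line (iter j (@diag n R) (schur n R la)) (x \o s) v; split.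
  rewrite -line0; apply: horner_ge0_lim_right => t t0.
  by rewrite horner_line; case: (near t t0 k).
have : 0 <= (S k.+1 ^+ 2 - S k * S k.+2).[0].
  apply: horner_ge0_lim_right => t t0.
  rewrite hornerD hornerN horner_exp hornerM !horner_line subr_ge0.
  by case: (near t t0 k).
by rewrite hornerD hornerN horner_exp hornerM !line0 subr_ge0.
Qed.

Lemma schur_derived_log_concave la x : is_partition la -> (forall i, 0 <= x i) ->
  let a i := (schur_derived n R la i).@[x] in
  (forall i, 0 <= a i) /\ (forall i, a (i - 1) * a (i + 1) <= a i ^+ 2).
Proof.
move=> hla x0 a; have ok := schur_diag_log_concave hla x0.
have ge0 i : 0 <= a i.
  rewrite /a.
  case: i => k; last by rewrite meval0.
  have [+ _] := ok k; rewrite -schur_derivedE.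
  by rewrite pmulr_lge0 // ltr0n fact_gt0.
have aN k : a (Negz k) = 0 by exact: meval0.
have okE (k : nat) : a k * (k`!)%:R * (a k.+2 * (k.+2`!)%:R)
    <= (a k.+1 * (k.+1`!)%:R) ^+ 2.
  by have [_] := ok k; rewrite -!schur_derivedE.
clearbody a; split=> // i; case: i => [[|k]|k].
- by rewrite (_ : 0%:Z - 1 = Negz 0) // aN mul0r sqr_ge0.
- have -> : k.+1%:Z - 1 = k by lia.
  have -> : k.+1%:Z + 1 = k.+2 by lia.
  move: (okE k) (ge0 k.+1) (ge0 k) (ge0 k.+2).
  move: (a k) (a k.+1) (a k.+2) => u v w + v0 u0 w0.
  have f0 : 0 < (k`!)%:R :> R by rewrite ltr0n fact_gt0.
  rewrite !factS !natrM; move: (k`!%:R) f0 => f f0 H.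
  have k1 : 0 < k.+1%:R :> R by [].
  (* Cancelling the factorials leaves the weights [k.+2] and [k.+1], which make the inequality
     stronger than log-concavity. *)
  have {H} : u * w * k.+2%:R <= v ^+ 2 * k.+1%:R.
    rewrite -(ler_pM2r (x := k.+1%:R * f ^+ 2)); last by rewrite mulr_gt0 ?exprn_gt0.
    suff -> : v ^+ 2 * k.+1%:R * (k.+1%:R * f ^+ 2) = (v * (k.+1%:R * f)) ^+ 2.
      by apply: le_trans H; rewrite le_eqVlt; apply/orP; left; apply/eqP; ring.
    by ring.
  move=> H; rewrite -(ler_pM2r (x := k.+2%:R)) //; apply: le_trans H _.
  by rewrite ler_wpM2l ?sqr_ge0 // ler_nat.
- rewrite (_ : Negz k - 1 = Negz k.+1); last by lia.
  by rewrite aN mul0r sqr_ge0.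
Qed.

End SchurDerived.

Theorem corollary10p10 (R : realType) (la mu : seq nat)
    (hla : is_partition la) (hmu : is_partition mu)
    (d : int) (hd : d <= (sumn la)%:Z + (sumn mu)%:Z)
    (e f : nat) (he : (1 <= e)%N) (hf : (1 <= f)%N)
    (x : 'I_e -> R) (y : 'I_f -> R)
    (hx : forall j, 0 <= x j) (hy : forall j, 0 <= y j) :
  log_concave (fun i : int =>
    (schur_derived e R la ((sumn la)%:Z + (sumn mu)%:Z - d - i)).@[x] *
    (schur_derived f R mu i).@[y]).
Proof.
have [a0 aa] := schur_derived_log_concave hla hx.
have [b0 bb] := schur_derived_log_concave hmu hy.
split=> i; first exact: mulr_ge0.
rewrite mulrACA exprMn; apply: ler_pM => //; try exact: mulr_ge0.
(* Reversing the index exchanges the two outer factors, hence the commutation. *)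
set D := _ - d; rewrite mulrC (_ : D - (i + 1) = D - i - 1); last by lia.
by rewrite (_ : D - (i - 1) = D - i + 1); [apply: aa | lia].
Qed.
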